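(* Let $K\subset\mathbb{C}$ be an infinite compact set and let $w_1,w_2:K\to[0,\infty)$ be bounded weight functions, each nonzero at infinitely many points of $K$, and suppose that $w_2(z)\neq0$ for all $z\in K$. Then $$t_n(K,w_1) \leq \Bigl(\sup_{z\in K}\frac{w_1(z)}{w_2(z)}\Bigr)\,t_n(K,w_2), \qquad n\in\mathbb{N}.$$ In particular, if $w:K\to[0,\infty)$ is a bounded weight function nonzero at infinitely many points of $K$ and $w_0=1$ is the constant weight, then $$\Bigl(\inf_{z\in K}w(z)\Bigr)\,t_n(K,w_0) \leq t_n(K,w) \leq \Bigl(\sup_{z\in K}w(z)\Bigr)\,t_n(K,w_0), \qquad n\in\mathbb{N}.$$
   Context: For a bounded weight $w:K\to[0,\infty)$ nonzero at infinitely many points of $K$, $\|P\|_{K,w}=\sup_{z\in K}w(z)|P(z)|$, and $t_n(K,w)$ is the minimum of $\|P\|_{K,w}$ over all monic polynomials $P$ of degree $n$ with complex coefficients (the minimum is attained and positive). The supremum of $w_1/w_2$ may be $+\infty$, in which case the right-hand side of the first inequality is $+\infty$. *)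

(* Defs.v *)
From mathcomp Require Export all_boot all_order all_algebra.
From mathcomp Require Export all_classical all_reals all_analysis.
From mathcomp Require Export complex.

Set Implicit Arguments.
Unset Strict Implicit.
Unset Printing Implicit Defensive.

Import Order.TTheory GRing.Theory Num.Theory.
Import numFieldNormedType.Exports.

Local Open Scope classical_set_scope.
Local Open Scope ring_scope.
Local Open Scope complex_scope.

(* R[i] carries its usual topology through the alias R[i]^o. A weight on K is
   a function on all of R[i] of which only the values on K matter. *)
Definition weight (R : realType) (K : set R[i]^o) (w : R[i]^o -> R) : Prop :=
  [/\ forall z, K z -> 0 <= w z,
      has_ubound (w @` K) &
      infinite_set [set z | K z /\ w z != 0]].

Definition wnorm (R : realType) (K : set R[i]^o) (w : R[i]^o -> R)
    (P : {poly R[i]}) : \bar R :=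
  ereal_sup [set (w z * Normc.normc P.[z])%:E | z in K].

(* The minimum of the weighted norm over the monic polynomials of degree n. It
   is written as an infimum in \bar R: this is the minimum whenever the latter
   exists, as it does for every weight on K. *)
Definition cheb (R : realType) (K : set R[i]^o) (w : R[i]^o -> R) (n : nat) :
    \bar R :=
  ereal_inf [set wnorm K w P | P in [set P | P \is monic /\ size P = n.+1]].

(* Main.v *)
Require Import Defs.
From mathcomp Require Import qpoly.
Import Order.TTheory GRing.Theory Num.Theory.
Import numFieldNormedType.Exports.
Local Open Scope classical_set_scope.
Local Open Scope ring_scope.
Local Open Scope complex_scope.

(** A pointwise inequality [w1 <= S w2] passes to the weighted norms of each
    polynomial, and then to their infima. When [S = +oo] this last step needs
    [cheb K w2 n > 0], because [+oo * 0 = 0] in [\bar R]. If [x_0, ..., x_n]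
    are distinct points of [K] where [w2 <> 0], Lagrange interpolation writes
    the leading coefficient [1] of [P] as a fixed linear combination of the
    [P(x_i)], so the [w2(x_i) |P(x_i)|] cannot all be small. *)

Lemma normc_ge0 (R : realType) (z : R[i]) : 0 <= Normc.normc z.
Proof. by have := normr_ge0 z; rewrite /Num.norm /= lecR. Qed.

Lemma normc_sum (R : realType) (I : Type) (r : seq I) (F : I -> R[i]) :
  Normc.normc (\sum_(i <- r) F i) <= \sum_(i <- r) Normc.normc (F i).
Proof.
elim/big_rec2: _ => [|i y x _ xy]; first by rewrite Normc.normc0.
by rewrite (le_trans (le_normcD _ _))// lerD2l.
Qed.

Lemma wnorm_monic_lbound {R : realType} {K : set R[i]^o} {w : R[i]^o -> R}
    (wK : weight K w) (n : nat) :
  exists2 c : R, 0 < c & forall P : {poly R[i]}, P \is monic ->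
    size P = n.+1 -> (c%:E <= wnorm K w P)%E.
Proof.
(* [f] injects the naturals into the points of [K] where [w] is nonzero; its first [n.+1] values
   serve as interpolation nodes. *)
have [w0 _ /infiniteP/ppcard_leP[f]] := wK.
have f_inj : injective f by move=> i j; apply: inj; rewrite inE.
have Kf i : K (f i) by have [] : [set z | K z /\ w z != 0] (f i) by exact: funS.
have wf i : 0 < w (f i).
  have [_ wn0] : [set z | K z /\ w z != 0] (f i) by exact: funS.
  by rewrite lt_def wn0 w0.
pose b (i : 'I_n.+1) : R :=
  Normc.normc (tnth (n.+1.-lagrange f) i : {poly R[i]})`_n.
(* The summand [1] makes [C] positive and strictly larger than the sum. The hypothesis [small]
   enters below only as a weak inequality, so the strict one in the contradiction [1 < 1] comes from
   here. *)
pose C := 1 + \sum_(i < n.+1) b i / w (f i).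
have b0 i : 0 <= b i by exact: normc_ge0.
have C0 : 0 < C.
  by rewrite ltr_wpDr// sumr_ge0// => i _; rewrite divr_ge0// ltW.
exists C^-1; first by rewrite invr_gt0.
move=> P /monicP Pmonic sP.
suff [i Pi] : exists i : 'I_n.+1, C^-1 <= w (f i) * Normc.normc P.[f i].
  by apply: le_ereal_sup_tmp; exists (w (f i) * Normc.normc P.[f i])%:E;
     [exists (f i)|rewrite lee_fin].
apply: contrapT => /forallNP small.
(* Compare the coefficients of degree [n] in the Lagrange expansion of [P], which is exact because
   [P] has size [n.+1], the number of nodes. *)
have P1 : 1 = \sum_(i < n.+1)
    P.[f i] * (tnth (n.+1.-lagrange f) i : {poly R[i]})`_n.
  have := Pmonic; rewrite lead_coefE sP /= => <-.
  rewrite [P in LHS](@lagrange_gen _ n.+1 f)// ?sP// coef_sum.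
  by apply: eq_bigr => i _; rewrite coefCM.
suff : 1 < 1 :> R by rewrite ltxx.
rewrite -[X in X < _](Normc.normc1 R) P1.
apply: le_lt_trans; [exact: normc_sum|].
apply: (@le_lt_trans _ _ (C^-1 * \sum_(i < n.+1) b i / w (f i))).
  rewrite mulr_sumr; apply: ler_sum => i _.
  rewrite Normc.normcM -/(b i) mulrCA [leLHS]mulrC ler_wpM2l//.
  by rewrite ler_pdivlMr// mulrC; move/negP: (small i); rewrite -ltNge => /ltW.
by rewrite mulrC ltr_pdivrMr// mul1r /C ltrDr.
Qed.

(** The lower bound [c] is the same for all monic [P] of degree [n], so it survives the infimum. *)
Lemma cheb_gt0 {R : realType} {K : set R[i]^o} {w : R[i]^o -> R}
    (wK : weight K w) (n : nat) : (0 < cheb K w n)%E.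
Proof.
have [c c0 cP] := wnorm_monic_lbound wK n.
apply: (@lt_le_trans _ _ c%:E); first by rewrite lte_fin.
by apply: le_ereal_inf_tmp => _ [P [Pmonic sP] <-]; exact: cP.
Qed.

Lemma wnorm_le_scale {R : realType} {K : set R[i]^o} {w1 w2 : R[i]^o -> R}
    {S : \bar R} (P : {poly R[i]}) :
  (0 <= S)%E -> (forall z, K z -> 0 <= w2 z) ->
  (forall z, K z -> ((w1 z)%:E <= S * (w2 z)%:E)%E) ->
  (wnorm K w1 P <= S * wnorm K w2 P)%E.
Proof.
move=> S0 w20 w12; apply: ge_ereal_sup => _ [z Kz <-].
have P0 : (0 <= (Normc.normc P.[z])%:E)%E by rewrite lee_fin normc_ge0.
apply: (@le_trans _ _ (S * (w2 z * Normc.normc P.[z])%:E)%E).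
  by rewrite !EFinM muleA lee_wpmul2r// w12.
by rewrite lee_wpmul2l//; apply: ereal_sup_ubound; exists z.
Qed.

Lemma cheb_le_scale {R : realType} {K : set R[i]^o} {w1 w2 : R[i]^o -> R}
    {S : \bar R} (n : nat) :
  weight K w2 -> (0 < S)%E ->
  (forall z, K z -> ((w1 z)%:E <= S * (w2 z)%:E)%E) ->
  (cheb K w1 n <= S * cheb K w2 n)%E.
Proof.
move=> w2K S0 w12; have [w20 _ _] := w2K.
case: S S0 w12 => [s| |]//= s0 w12; last first.
  by rewrite gt0_mulye ?cheb_gt0// leey.
(* Moving the finite factor [s] to the left leaves the bare infimum on the right, which can then be
   bounded below one polynomial at a time. *)
rewrite -lee_pdivrMl//; apply: le_ereal_inf_tmp => _ [P sP <-].
rewrite lee_pdivrMl//; apply: le_trans (wnorm_le_scale P (ltW s0) w20 w12).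
by apply: ereal_inf_lbound; exists P.
Qed.

Lemma weight_cst1 {R : realType} {K : set R[i]^o} :
  infinite_set K -> weight K (fun=> 1).
Proof.
move=> K_infinite; split=> //; first by exists 1 => _ [z _ <-].
apply: contra_not K_infinite; apply: sub_finite_set => z Kz.
by split=> //; exact: oner_neq0.
Qed.

Lemma weight_gt0_point {R : realType} {K : set R[i]^o} {w : R[i]^o -> R} :
  weight K w -> exists2 z, K z & 0 < w z.
Proof.
by move=> [w0 _ /infinite_setN0[z [Kz wz]]]; exists z => //; rewrite lt_def wz w0.
Qed.

Lemma cheb_le_sup_ratio {R : realType} {K : set R[i]^o} {w1 w2 : R[i]^o -> R}
    (n : nat) :
  weight K w1 -> weight K w2 -> (forall z, K z -> w2 z != 0) ->
  (cheb K w1 n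
     <= ereal_sup [set (w1 z / w2 z)%:E | z in K] * cheb K w2 n)%E.
Proof.
move=> w1K w2K w2n0; have [w20 _ _] := w2K.
have w2gt0 z : K z -> 0 < w2 z by move=> Kz; rewrite lt_def w2n0// w20.
have ratio_le z (Kz : K z) :
    ((w1 z / w2 z)%:E <= ereal_sup [set (w1 z / w2 z)%:E | z in K])%E.
  by apply: ereal_sup_ubound; exists z.
apply: cheb_le_scale => //.
  (* The supremum is positive because the ratio is positive wherever [w1] is. *)
  have [z Kz w1z] := weight_gt0_point w1K.
  by apply: lt_le_trans (ratio_le z Kz); rewrite lte_fin divr_gt0// w2gt0.
move=> z Kz; rewrite -[w1 z](divfK (w2n0 z Kz)) EFinM.
by rewrite lee_wpmul2r ?lee_fin ?w20// ratio_le.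
Qed.

Theorem theorem11 (R : realType) (K : set R[i]^o)
    (K_compact : compact K) (K_infinite : infinite_set K) :
  (forall w1 w2 : R[i]^o -> R,
     weight K w1 -> weight K w2 -> (forall z, K z -> w2 z != 0) ->
     forall n : nat,
       (cheb K w1 n
          <= ereal_sup [set (w1 z / w2 z)%:E | z in K] * cheb K w2 n)%E)
  /\
  (forall w : R[i]^o -> R,
     weight K w ->
     forall n : nat,
       (ereal_inf [set (w z)%:E | z in K] * cheb K (fun=> 1%R) n
          <= cheb K w n)%E /\
       (cheb K w n
          <= ereal_sup [set (w z)%:E | z in K] * cheb K (fun=> 1%R) n)%E).
Proof.
have w1K := weight_cst1 K_infinite.
split=> [w1 w2 w1K' w2K w2n0 n|w wK n]; first exact: cheb_le_sup_ratio.
split; last first.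
  have -> : [set (w z)%:E | z in K] = [set (w z / 1)%:E | z in K].
    by apply: eq_imagel => z _; rewrite divr1.
  by apply: cheb_le_sup_ratio => // z _; exact: oner_neq0.
have [w0 _ _] := wK; have [z0 Kz0 _] := weight_gt0_point wK.
have inf_le z (Kz : K z) : (ereal_inf [set (w z)%:E | z in K] <= (w z)%:E)%E.
  by apply: ereal_inf_lbound; exists z.
have inf_ge0 : (0 <= ereal_inf [set (w z)%:E | z in K])%E.
  by apply: le_ereal_inf_tmp => _ [z Kz <-]; rewrite lee_fin w0.
(* The infimum is finite: it is nonnegative, and at most the real number [w z0]. *)
case: (ereal_inf _) inf_le inf_ge0 => [r| |] inf_le //=; last first.
  by have := inf_le z0 Kz0.
rewrite lee_fin le_eqVlt => /predU1P[<-|r0].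
  by rewrite mul0e ltW// cheb_gt0.
(* For [r > 0] the lower bound is the scaling inequality from the constant weight to [w] with factor
   [r^-1], since [1 <= r^-1 * w z] on [K]. This avoids identifying the supremum of [1 / w] with
   [r^-1]. *)
rewrite -lee_pdivlMl//; apply: cheb_le_scale => //.
  by rewrite lte_fin invr_gt0.
by move=> z Kz; rewrite lee_pdivlMl// mule1 inf_le.
Qed.
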